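(* Fix $s,p\in(1,2]$, $r>0$ and a linear objective $C\in\mathbb{R}^{m\times n}$. Let $X\in\mathbb{R}^{m\times n}$ be such that $$X_{i,j}=-\frac{r}{\|C\|_{z,q}^{q-1}\,\|C_i\|_z^{z-q}}\,\mathrm{sgn}(C_{i,j})\,|C_{i,j}|^{z-1},$$ where $z$ satisfies $\frac1s+\frac1z=1$, $q$ satisfies $\frac1p+\frac1q=1$, and $C_i$ denotes the $i$th row of $C$. Then $X=\arg\min_{Y\in\mathbb{B}_{s,p}(r)}Y\bullet C$, where $\mathbb{B}_{s,p}(r)=\{Y\in\mathbb{R}^{m\times n}:\|Y\|_{s,p}\le r\}$.
   Context: For $X\in\mathbb{R}^{m\times n}$ with rows $X_1,\dots,X_m\in\mathbb{R}^n$, and exponents $a,b\ge 1$, the group norm is $\|X\|_{a,b}=\big\|(\|X_1\|_a,\dots,\|X_m\|_a)\big\|_b$, where $\|\cdot\|_a,\|\cdot\|_b$ are the usual vector $\ell_a,\ell_b$ norms. The symbol $\bullet$ denotes the standard inner product of matrices, $Y\bullet C=\sum_{i,j}Y_{i,j}C_{i,j}$, and $\mathrm{sgn}(\cdot)$ is the sign function. *)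

(* Defs.v *)
(* Built on MathComp and MathComp-Analysis. *)
From HB Require Import structures.
From mathcomp Require Import all_boot all_order all_algebra.
From mathcomp Require Import boolp classical_sets reals exp.

Set Implicit Arguments.
Unset Strict Implicit.
Unset Printing Implicit Defensive.

Import Order.TTheory GRing.Theory Num.Theory.
Local Open Scope classical_set_scope.
Local Open Scope ring_scope.

Definition lnorm (R : realType) (n : nat) (a : R) (x : 'rV[R]_n) : R :=
  (\sum_(j < n) `|x 0 j| `^ a) `^ a^-1.

(* The inner exponent a acts along each row, the outer exponent b across rows. *)
Definition group_norm (R : realType) (m n : nat) (a b : R) (X : 'M[R]_(m, n)) :
    R :=
  lnorm b (\row_(i < m) lnorm a (row i X)).

Definition mxdot (R : realType) (m n : nat) (Y C : 'M[R]_(m, n)) : R :=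
  \sum_(i < m) \sum_(j < n) Y i j * C i j.

Definition group_ball (R : realType) (m n : nat) (s p r : R) :
    set 'M[R]_(m, n) :=
  [set Y | group_norm s p Y <= r].

(* The set of all minimizers of f over D. *)
Definition argmin (R : realType) (T : Type) (D : set T) (f : T -> R) : set T :=
  [set x | D x /\ forall y, D y -> f x <= f y].

(* Main.v *)
(** For a nonzero vector c and conjugate exponents s and z, the vector
    [holder_dual z rho c] has s-norm rho and is the unique maximizer of the
    inner product with c among the vectors of s-norm at most rho: this is
    Hölder's inequality with its equality case, itself obtained from the equality
    case of Young's inequality. The matrix -X is this construction applied twice:
    first to the vector of row norms of C, which yields the norms of the rows of
    -X, then to each row of C, which yields the rows themselves. *)
Require Import Defs.
From HB Require Import structures.
From mathcomp Require Import all_boot all_order all_algebra.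
From mathcomp Require Import boolp classical_sets reals sequences exp.
From mathcomp Require Import ring lra.

Set Implicit Arguments.
Unset Strict Implicit.
Unset Printing Implicit Defensive.

Import Order.TTheory GRing.Theory Num.Theory.
Local Open Scope classical_set_scope.
Local Open Scope ring_scope.

(** * Conjugate exponents and the equality case of Young's inequality *)

Lemma conjugate_exponent_gt1 (R : realType) (s z : R) :
  1 < s -> s^-1 + z^-1 = 1 -> 1 < z.
Proof.
move=> s1 h.
have s0 : 0 < s by rewrite (lt_trans _ s1).
have si : s^-1 < 1 by rewrite invf_lt1.
have sp : 0 < s^-1 by rewrite invr_gt0.
have zi : 0 < z^-1 by lra.
have z0 : 0 < z by rewrite -invr_gt0.
by rewrite -invf_lt1//; lra.
Qed.

(** Clearing denominators gives [z + s = s * z]. In this form conjugacy turns the [s]-th power of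
    [|c| ^ (z - 1)] into [|c| ^ z]. *)
Lemma conjugate_exponent_mul (R : realType) (s z : R) :
  1 < s -> s^-1 + z^-1 = 1 -> (z - 1) * s = z.
Proof.
move=> s1 h; have z1 := conjugate_exponent_gt1 s1 h.
have s0 : s != 0 by rewrite gt_eqF// (lt_trans _ s1).
have z0 : z != 0 by rewrite gt_eqF// (lt_trans _ z1).
have : (s^-1 + z^-1) * s * z = s * z by rewrite h mul1r.
have -> : (s^-1 + z^-1) * s * z = z + s by field; rewrite s0 z0.
by rewrite mulrBl mul1r mulrC => <-; rewrite addrK.
Qed.

Lemma powR_young_eq (R : realType) (s z a b : R) : 1 < s -> s^-1 + z^-1 = 1 ->
  0 <= a -> 0 <= b -> a * b = a `^ s / s + b `^ z / z -> a = b `^ (z - 1).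
Proof.
move=> s1 h a0 b0; have z1 := conjugate_exponent_gt1 s1 h.
have s0 : 0 < s by rewrite (lt_trans _ s1).
have z0 : 0 < z by rewrite (lt_trans _ z1).
have zB : z - 1 != 0 by rewrite subr_eq0 gt_eqF.
(* Logarithms need positive arguments. If one of [a], [b] vanishes, equality makes the other vanish
   too, and [0 ^ (z - 1) = 0] because [z] is not 1. *)
move: a0; rewrite le_eqVlt => /predU1P[<-|a0].
  rewrite mul0r powR0 ?gt_eqF// mul0r add0r => /esym/eqP.
  rewrite mulf_eq0 invr_eq0 (gt_eqF z0) orbF powR_eq0 => /andP[/eqP-> _].
  by rewrite powR0.
move: b0; rewrite le_eqVlt => /predU1P[<-|b0].
  rewrite mulr0 (powR0 (lt0r_neq0 z0)) mul0r addr0 => /esym/eqP.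
  rewrite mulf_eq0 invr_eq0 (gt_eqF s0) orbF powR_eq0 => /andP[/eqP-> _].
  by rewrite powR0.
set A := s * ln a; set B := z * ln b.
(* Both exponentials lie above the tangent to [expR] at the mean [M], strictly
   so unless [A = B]. *)
set M := A / s + B / z => E.
have ME : expR M = a * b.
  rewrite /M /A /B [s * _]mulrC [z * _]mulrC !mulfK ?gt_eqF// expRD !lnK//.
have AE : a `^ s = expR M * expR (A - M).
  by rewrite -expRD subrKC /powR gt_eqF.
have BE : b `^ z = expR M * expR (B - M).
  by rewrite -expRD subrKC /powR gt_eqF.
move: E; rewrite -ME AE BE -!mulrA -mulrDr => /esym/eqP.
rewrite -{2}[expR M]mulr1 => /eqP.
move/(mulfI (lt0r_neq0 (expR_gt0 M))) => E.
have si : 0 < s^-1 by rewrite invr_gt0.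
have zi : 0 < z^-1 by rewrite invr_gt0.
have AM : A = M.
  apply/eqP; apply/negPn/negP => AM.
  have : (1 + (A - M)) / s < expR (A - M) / s.
    by rewrite ltr_pM2r// expR_gt1Dx// subr_eq0.
  have : (1 + (B - M)) / z <= expR (B - M) / z.
    by rewrite ler_pM2r// expR_ge1Dx.
  have : (1 + (A - M)) / s + (1 + (B - M)) / z = 1.
    transitivity ((s^-1 + z^-1) * (1 - M) + M); last by rewrite h; ring.
    by rewrite /M; ring.
  lra.
have AB : A = B.
  have : M * (s^-1 + z^-1) = A / s + B / z by rewrite h mulr1.
  rewrite mulrDr -{1}AM => /addrI/(mulIf (lt0r_neq0 zi)) MB.
  by rewrite AM MB.
(* [A = B] is [a ^ s = b ^ z] in logarithms. Multiplying by [z - 1] and cancelling [z] leaves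
   [ln a = (z - 1) * ln b]. *)
have : (z - 1) * s * ln a = (z - 1) * B by rewrite -AB mulrA.
rewrite (conjugate_exponent_mul s1 h) /B mulrCA => /(mulfI (lt0r_neq0 z0)) L.
by rewrite /powR gt_eqF// -L lnK.
Qed.

(** * Hölder's inequality for vectors and its equality case *)

Definition rowdot (R : realType) (n : nat) (x y : 'rV[R]_n) : R :=
  \sum_(j < n) x 0 j * y 0 j.

(** For [c != 0] and [1 < z] this is [rho] times the gradient of the [z]-norm at [c]. *)
Definition holder_dual (R : realType) (n : nat) (z rho : R) (c : 'rV[R]_n) :
    'rV[R]_n :=
  \row_(j < n) (rho / lnorm z c `^ (z - 1) * Num.sg (c 0 j) *
                `|c 0 j| `^ (z - 1)).

Section Lnorm.
Context (R : realType) (n : nat).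
Implicit Types (x y c : 'rV[R]_n) (a s z rho : R).

Lemma lnorm_ge0 a x : 0 <= lnorm a x.
Proof. exact: powR_ge0. Qed.

Lemma sum_powR_ge0 a x : 0 <= \sum_(j < n) `|x 0 j| `^ a.
Proof. by apply: sumr_ge0 => j _; exact: powR_ge0. Qed.

Lemma powR_lnorm a x : a != 0 -> lnorm a x `^ a = \sum_(j < n) `|x 0 j| `^ a.
Proof.
by move=> a0; rewrite /lnorm -powRrM mulVf// powRr1// sum_powR_ge0.
Qed.

Lemma lnorm0 a : a != 0 -> lnorm a (0 : 'rV[R]_n) = 0.
Proof.
move=> a0; rewrite /lnorm big1 ?powR0 ?invr_eq0// => j _.
by rewrite mxE normr0 powR0.
Qed.

Lemma lnorm_eq0 a x : a != 0 -> lnorm a x = 0 -> x = 0.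
Proof.
move=> a0 xa; have := powR_lnorm x a0; rewrite xa powR0// => /esym/eqP.
rewrite psumr_eq0 => [/allP h|j _]; last exact: powR_ge0.
apply/rowP => j; rewrite mxE; have /implyP := h j (mem_index_enum j).
by move=> /(_ isT)/eqP/powR_eq0_eq0/eqP; rewrite normr_eq0 => /eqP.
Qed.

Lemma lnorm_gt0 a x : a != 0 -> x != 0 -> 0 < lnorm a x.
Proof.
move=> a0 x0; rewrite lt_neqAle lnorm_ge0 andbT eq_sym.
by apply: contra_neq x0; exact: lnorm_eq0.
Qed.

Lemma lnormN a x : lnorm a (- x) = lnorm a x.
Proof.
by rewrite /lnorm; congr (_ `^ _); apply: eq_bigr => j _; rewrite mxE normrN.
Qed.

Lemma lnormZ a rho x : a != 0 -> lnorm a (rho *: x) = `|rho| * lnorm a x.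
Proof.
move=> a0; rewrite /lnorm.
under eq_bigr do rewrite mxE normrM powRM//.
by rewrite -mulr_sumr powRM ?powR_ge0 ?sum_powR_ge0// -powRrM mulfV// powRr1.
Qed.

Lemma holder_dual0 z rho : holder_dual z rho (0 : 'rV[R]_n) = 0.
Proof. by apply/rowP => j; rewrite !mxE sgr0 mulr0 mul0r. Qed.

Lemma holder_dualZ z rho c : holder_dual z rho c = rho *: holder_dual z 1 c.
Proof. by apply/rowP => j; rewrite !mxE mul1r !mulrA. Qed.

Section Conjugate.
Variables (s z : R).
Hypotheses (s1 : 1 < s) (sz : s^-1 + z^-1 = 1).

Let z1 : 1 < z. Proof. exact: conjugate_exponent_gt1 sz. Qed.
Let s0 : 0 < s. Proof. by rewrite (lt_trans _ s1). Qed.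
Let z0 : 0 < z. Proof. by rewrite (lt_trans _ z1). Qed.
Let sN0 : s != 0. Proof. exact: lt0r_neq0. Qed.
Let zN0 : z != 0. Proof. exact: lt0r_neq0. Qed.

Lemma lnorm_holder_dual rho c : 0 <= rho -> c != 0 ->
  lnorm s (holder_dual z rho c) = rho.
Proof.
move=> rho0 c0; have N0 := lnorm_gt0 zN0 c0.
rewrite holder_dualZ lnormZ// ger0_norm// -[RHS]mulr1; congr (_ * _).
rewrite /lnorm; under eq_bigr => j _.
  rewrite mxE mul1r normrM normrM ger0_norm ?invr_ge0 ?powR_ge0//.
  rewrite (ger0_norm (powR_ge0 _ _)) -mulrA.
  (* The sign has absolute value 1 except where [c 0 j = 0]; there the power vanishes as well. *)
  rewrite (_ : `|Num.sg _| * _ = `|c 0 j| `^ (z - 1)); last first.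
    have [->|cj0] := eqVneq (c 0 j) 0; last by rewrite normr_sg cj0 mul1r.
    by rewrite sgr0 !normr0 powR0 ?mul0r// subr_eq0 gt_eqF.
  rewrite powRM ?invr_ge0 ?powR_ge0// -powRrM (conjugate_exponent_mul s1 sz).
  over.
rewrite -mulr_sumr -powR_lnorm// -powRN -powRrM mulNr.
rewrite (conjugate_exponent_mul s1 sz) -powRD ?addNr ?powRr0 ?powR1//.
by rewrite lt0r_neq0// implybT.
Qed.

Lemma rowdot_holder_dual rho c :
  c != 0 -> rowdot (holder_dual z rho c) c = rho * lnorm z c.
Proof.
move=> c0; have N0 := lnorm_gt0 zN0 c0.
have E j : holder_dual z rho c 0 j * c 0 j =
    rho / lnorm z c `^ (z - 1) * `|c 0 j| `^ z.
  rewrite mxE -(mulr_powRB1 (normr_ge0 (c 0 j)) z0).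
  by rewrite [X in _ = _ * (X * _)]normrEsg; ring.
rewrite /rowdot; under eq_bigr do rewrite E.
rewrite -mulr_sumr -powR_lnorm// -(mulr_powRB1 (lnorm_ge0 _ _) z0).
by rewrite mulrA mulrAC divfK// gt_eqF// powR_gt0.
Qed.

(* Young's inequality is applied to the entries of the normalized vectors
   [rho^-1 *: x] and [c / lnorm z c]. *)
Lemma holder_rowdot_young rho x c : 0 < rho -> c != 0 -> lnorm s x <= rho ->
  rowdot x c <= rho * lnorm z c /\
  (rowdot x c = rho * lnorm z c -> x = holder_dual z rho c).
Proof.
move=> rho0 c0 xrho; have N0 := lnorm_gt0 zN0 c0.
set N := lnorm z c in N0 *.
pose t j := x 0 j / rho; pose u j := c 0 j / N.
pose Y j := `|t j| `^ s / s + `|u j| `^ z / z.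
have tE j : `|t j| `^ s = rho `^ (- s) * `|x 0 j| `^ s.
  rewrite normf_div (gtr0_norm rho0) powRM ?invr_ge0 ?(ltW rho0)//.
  by rewrite -(powR_inv1 (ltW rho0)) -powRrM mulN1r mulrC.
have uE j : `|u j| `^ z = N `^ (- z) * `|c 0 j| `^ z.
  rewrite normf_div (gtr0_norm N0) powRM ?invr_ge0 ?(ltW N0)//.
  by rewrite -(powR_inv1 (ltW N0)) -powRrM mulN1r mulrC.
have St : \sum_(j < n) `|t j| `^ s = (lnorm s x / rho) `^ s.
  rewrite powRM ?lnorm_ge0 ?invr_ge0 ?(ltW rho0)// powR_lnorm// mulrC mulr_sumr.
  by apply: eq_bigr => j _; rewrite tE -(powR_inv1 (ltW rho0)) -powRrM mulN1r.
have Su : \sum_(j < n) `|u j| `^ z = 1.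
  rewrite -(mulVf (lt0r_neq0 (powR_gt0 z N0))) -powRN powR_lnorm// mulr_sumr.
  by apply: eq_bigr => j _; rewrite uE.
(* The sum is [(lnorm s x / rho) ^ s / s + 1 / z], and the ratio is at most 1. *)
have Y1 : \sum_(j < n) Y j <= 1.
  rewrite /Y big_split/= -!mulr_suml St Su mul1r -sz lerD2r.
  rewrite ler_piMl ?invr_ge0 ?(ltW s0)//.
  have <- : 1 `^ s = 1 :> R by rewrite powR1.
  apply: ge0_ler_powR (ltW s0) _ _ _ _ _; rewrite ?nnegrE//.
    by rewrite divr_ge0 ?lnorm_ge0 ?ltW.
  by rewrite ler_pdivrMr ?mul1r.
have tuY j : t j * u j <= Y j.
  by rewrite (le_trans (ler_norm _))// normrM conjugate_powR.
have xcE : rowdot x c = rho * N * \sum_(j < n) t j * u j.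
  rewrite mulr_sumr; apply: eq_bigr => j _; rewrite /t /u.
  by field; rewrite !gt_eqF.
have rN : 0 < rho * N by rewrite mulr_gt0.
have tu1 : \sum_(j < n) t j * u j <= 1.
  by rewrite (le_trans _ Y1)//; apply: ler_sum.
split=> [|E]; first by rewrite xcE -[leRHS]mulr1 ler_pM2l.
have {}E : \sum_(j < n) t j * u j = 1.
  by apply: (mulfI (lt0r_neq0 rN)); rewrite -xcE mulr1.
(* The slacks in Young's inequality are nonnegative and their sum is at most [1 - 1], so each of
   them vanishes. *)
have D0 : \sum_(j < n) (Y j - t j * u j) = 0.
  apply/eqP; rewrite eq_le sumr_ge0 ?andbT => [|j _]; last by rewrite subr_ge0.
  by rewrite sumrB E subr_le0.
have YE j : Y j = t j * u j.
  move/eqP: D0; rewrite psumr_eq0 => [/allP h|k _]; last by rewrite subr_ge0.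
  by apply/eqP; rewrite -subr_eq0; exact: (implyP (h j (mem_index_enum j))).
apply/rowP => j.
(* The chain [t j * u j <= |t j| * |u j| <= Y j] collapses: its first equality aligns the signs, its
   second is the equality case of Young's inequality. *)
have tuN : t j * u j = `|t j| * `|u j|.
  apply/eqP; rewrite eq_le (le_trans (ler_norm _)) ?(normrM (t j))//= -YE.
  exact: conjugate_powR.
have tN : `|t j| = `|u j| `^ (z - 1).
  by apply: (powR_young_eq s1 sz) => //; rewrite -tuN -YE.
have tS : t j = Num.sg (u j) * `|u j| `^ (z - 1).
  rewrite -tN; have [u0|u0] := eqVneq (u j) 0.
    rewrite u0 sgr0 mul0r; apply/eqP; rewrite -normr_eq0 tN u0 normr0 powR0//.
    by rewrite subr_eq0 gt_eqF.
  apply: (mulIf u0); rewrite tuN mulrAC -[LHS]mulrC; congr (_ * _).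
  by rewrite normrEsg.
have -> : x 0 j = rho * t j by rewrite mulrC divfK// gt_eqF.
rewrite mxE tS /u sgrM sgrV (gtr0_sg N0) normf_div (gtr0_norm N0).
rewrite mulr1 powRM ?invr_ge0 ?(ltW N0)// -(powR_inv1 (ltW N0)).
by rewrite -powRrM mulN1r powRN; ring.
Qed.

Lemma holder_rowdot x c : rowdot x c <= lnorm s x * lnorm z c.
Proof.
have [->|c0] := eqVneq c 0.
  by rewrite lnorm0// mulr0 /rowdot big1// => j _; rewrite mxE mulr0.
have [->|x0] := eqVneq x 0.
  by rewrite lnorm0// mul0r /rowdot big1// => j _; rewrite mxE mul0r.
by have [] := holder_rowdot_young (lnorm_gt0 sN0 x0) c0 (lexx _).
Qed.

Lemma holder_rowdot_eq rho x c : c != 0 -> lnorm s x <= rho ->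
  rowdot x c = rho * lnorm z c -> x = holder_dual z rho c.
Proof.
move=> c0 xrho; have := le_trans (lnorm_ge0 _ _) xrho.
(* Normalizing by [rho] requires [0 < rho]; for [rho = 0] both sides are the zero vector. *)
rewrite le_eqVlt => /predU1P[rho0 _|rho0]; last first.
  by have [_] := holder_rowdot_young rho0 c0 xrho.
rewrite -rho0 holder_dualZ scale0r.
by apply: (lnorm_eq0 sN0); apply/eqP; rewrite eq_le lnorm_ge0 andbT rho0.
Qed.

End Conjugate.
End Lnorm.

(** * Hölder's inequality for group norms and its equality case *)

Section GroupNorm.
Context (R : realType) (m n : nat).
Implicit Types (C W Y : 'M[R]_(m, n)).

Definition row_norms (a : R) C : 'rV[R]_m := \row_(i < m) lnorm a (row i C).

Definition mx_holder_dual (z q r : R) C : 'M[R]_(m, n) :=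
  \matrix_(i < m) holder_dual z (holder_dual q r (row_norms z C) 0 i) (row i C).

Lemma row_normsE (a : R) C i : row_norms a C 0 i = lnorm a (row i C).
Proof. by rewrite mxE. Qed.

Lemma mxdot_rowdot W C : mxdot W C = \sum_(i < m) rowdot (row i W) (row i C).
Proof. by apply: eq_bigr => i _; apply: eq_bigr => j _; rewrite !mxE. Qed.

(* The rewrites are restricted to one factor each: comparing the two factors
   makes unification diverge. *)
Lemma rowdot_row_norms (a b : R) W C :
  rowdot (row_norms a W) (row_norms b C) =
  \sum_(i < m) lnorm a (row i W) * lnorm b (row i C).
Proof.
apply: eq_bigr => i _.
by rewrite [X in X * _]row_normsE [X in _ * X]row_normsE.
Qed.

Lemma mxdotN W C : mxdot (- W) C = - mxdot W C.
Proof.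
rewrite /mxdot -sumrN; apply: eq_bigr => i _; rewrite -sumrN.
by apply: eq_bigr => j _; rewrite mxE mulNr.
Qed.

Lemma group_normE (a b : R) W : group_norm a b W = lnorm b (row_norms a W).
Proof. by []. Qed.

Lemma group_norm_ge0 (a b : R) W : 0 <= group_norm a b W.
Proof. exact: lnorm_ge0. Qed.

Lemma group_normN (a b : R) W : group_norm a b (- W) = group_norm a b W.
Proof.
have E : row_norms a (- W) = row_norms a W.
  apply/rowP => i; rewrite [LHS]mxE [RHS]mxE -[RHS]lnormN.
  by have -> : row i (- W) = - row i W by apply/rowP => j; rewrite !mxE.
by rewrite !group_normE E.
Qed.

Lemma row_norms_neq0 (a : R) C : a != 0 -> C != 0 -> row_norms a C != 0.
Proof.
move=> a0; apply: contra_neq => C0; apply/row_matrixP => i.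
rewrite row0; apply: (lnorm_eq0 a0).
by move/rowP/(_ i) : C0; rewrite !mxE.
Qed.

Section Conjugate.
Variables (s z p q : R).
Hypotheses (s1 : 1 < s) (sz : s^-1 + z^-1 = 1).
Hypotheses (p1 : 1 < p) (pq : p^-1 + q^-1 = 1).

Let sN0 : s != 0. Proof. by rewrite gt_eqF// (lt_trans _ s1). Qed.
Let zN0 : z != 0.
Proof. by rewrite gt_eqF// (lt_trans _ (conjugate_exponent_gt1 s1 sz)). Qed.

Lemma row_norms_mx_holder_dual r C : 0 <= r ->
  row_norms s (mx_holder_dual z q r C) = holder_dual q r (row_norms z C).
Proof.
move=> r0; apply/rowP => i; rewrite mxE rowK.
(* A zero row of [C] has norm 0, so the outer dual prescribes norm 0 for it, through
   [Num.sg 0 = 0]. *)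
have [C0|C0] := eqVneq (row i C) 0.
  by rewrite C0 holder_dual0 lnorm0// !mxE C0 lnorm0// sgr0 mulr0 mul0r.
rewrite lnorm_holder_dual// mxE !mulr_ge0 ?invr_ge0 ?powR_ge0//.
by rewrite sgr_ge0 mxE lnorm_ge0.
Qed.

Lemma group_norm_mx_holder_dual r C : 0 <= r -> C != 0 ->
  group_norm s p (mx_holder_dual z q r C) = r.
Proof.
move=> r0 C0; rewrite group_normE row_norms_mx_holder_dual//.
by rewrite lnorm_holder_dual// row_norms_neq0.
Qed.

Lemma mxdot_mx_holder_dual r C : C != 0 ->
  mxdot (mx_holder_dual z q r C) C = r * group_norm z q C.
Proof.
move=> C0; rewrite -(rowdot_holder_dual p1 pq _ (row_norms_neq0 zN0 C0)).
rewrite mxdot_rowdot; apply: eq_bigr => i _; rewrite rowK.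
rewrite row_normsE; have [Ci0|Ci0] := eqVneq (row i C) 0.
  by rewrite Ci0 lnorm0// mulr0 /rowdot big1// => j _; rewrite !mxE mulr0.
by rewrite (rowdot_holder_dual s1 sz).
Qed.

Lemma mxdot_le_rowdot_norms W C :
  mxdot W C <= rowdot (row_norms s W) (row_norms z C).
Proof.
rewrite mxdot_rowdot rowdot_row_norms; apply: ler_sum => i _.
exact: (holder_rowdot s1 sz).
Qed.

Lemma holder_mxdot W C : mxdot W C <= group_norm s p W * group_norm z q C.
Proof.
exact: le_trans (mxdot_le_rowdot_norms _ _) (holder_rowdot p1 pq _ _).
Qed.

(* Equality in Hölder's inequality across the rows fixes the row norms of [W];
   equality within each row then fixes the rows. *)
Lemma holder_mxdot_eq r W C : C != 0 -> group_norm s p W <= r ->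
  mxdot W C = r * group_norm z q C -> W = mx_holder_dual z q r C.
Proof.
move=> C0 Wr E; have N0 := row_norms_neq0 zN0 C0.
(* A squeeze: the product of row norms lies between [mxdot W C], which equals the right-hand side by
   [E], and [group_norm s p W * group_norm z q C], which is at most that side. *)
have Eout : rowdot (row_norms s W) (row_norms z C) = r * group_norm z q C.
  apply/eqP; rewrite eq_le -{2}E mxdot_le_rowdot_norms andbT.
  apply: le_trans (holder_rowdot p1 pq _ _) _.
  by rewrite ler_wpM2r ?lnorm_ge0.
have WN := holder_rowdot_eq p1 pq N0 Wr Eout.
have D0 : \sum_(i < m) (lnorm s (row i W) * lnorm z (row i C) -
                        rowdot (row i W) (row i C)) = 0.
  by rewrite sumrB -mxdot_rowdot E -rowdot_row_norms Eout subrr.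
have D_ge0 i : 0 <= lnorm s (row i W) * lnorm z (row i C) -
                    rowdot (row i W) (row i C).
  by rewrite subr_ge0 (holder_rowdot s1 sz).
apply/row_matrixP => i; rewrite rowK -WN.
(* Over a zero row of [C] the inner equality case says nothing; there [WN] already makes the row
   norm of [W] zero. *)
have [Ci0|Ci0] := eqVneq (row i C) 0.
  rewrite Ci0 holder_dual0; apply: (lnorm_eq0 sN0).
  move/rowP/(_ i) : WN; rewrite !mxE Ci0 lnorm0// => ->.
  by rewrite sgr0 mulr0 mul0r.
apply: (holder_rowdot_eq s1 sz Ci0); first by rewrite row_normsE.
move/eqP: D0; rewrite psumr_eq0// => /allP/(_ i (mem_index_enum i))/=.
by rewrite subr_eq0 row_normsE eq_sym => /eqP.
Qed.

End Conjugate.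
End GroupNorm.

(* In a row with C_i = 0, and for C = 0, the conventions 0^-1 = 0 and
   Num.sg 0 = 0 make the formula for X evaluate to 0.  When C = 0 every point
   of the ball is a minimizer, so uniqueness is claimed only for C != 0. *)
Theorem lemma9 (R : realType) (m n : nat) (s p z q r : R)
    (C X : 'M[R]_(m, n))
    (hs : 1 < s <= 2) (hp : 1 < p <= 2) (hr : 0 < r)
    (hz : 1 / s + 1 / z = 1) (hq : 1 / p + 1 / q = 1)
    (hX : forall (i : 'I_m) (j : 'I_n),
      X i j = - (r / (group_norm z q C `^ (q - 1) *
                      lnorm z (row i C) `^ (z - q))) *
              Num.sg (C i j) * `|C i j| `^ (z - 1)) :
  argmin (@group_ball R m n s p r) (fun Y => mxdot Y C) X /\
  (C != 0 ->
   argmin (@group_ball R m n s p r) (fun Y => mxdot Y C) = [set X]).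

Proof.
have {hs}s1 : 1 < s by case/andP: hs.
have {hp}p1 : 1 < p by case/andP: hp.
rewrite !div1r in hz hq.
have s0 : s != 0 by rewrite gt_eqF// (lt_trans _ s1).
have p0 : p != 0 by rewrite gt_eqF// (lt_trans _ p1).
have z0 : z != 0.
  by rewrite gt_eqF// (lt_trans _ (conjugate_exponent_gt1 s1 hz)).
(* Splitting [z - q] as [(z - 1) - (q - 1)] separates the outer power of the row norm [c] from the
   inner normalization. The factor [1] is the sign of [c]. *)
have coefE (g c u v : R) : 0 < c ->
    - (r / (g * c `^ (z - q))) * u * v =
    - (r / g * 1 * c `^ (q - 1) / c `^ (z - 1) * u * v).
  move=> c0; have -> : z - q = (z - 1) - (q - 1) by ring.
  rewrite powRB ?(gt_eqF c0) ?implybT// invfM invf_div.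
  by ring.
have XE : X = - mx_holder_dual z q r C.
  apply/matrixP => i j; rewrite hX !mxE.
  have [Ci0|Ci0] := eqVneq (row i C) 0.
    move/rowP/(_ j) : Ci0; rewrite !mxE => ->.
    by rewrite sgr0 !(mulr0, mul0r) oppr0.
  have c0 := lnorm_gt0 z0 Ci0.
  by rewrite (gtr0_sg c0) (ger0_norm (ltW c0)) (coefE _ _ _ _ c0).
have opt : argmin (@group_ball R m n s p r) (fun Y => mxdot Y C) X.
  have [C0|C0] := eqVneq C 0.
    have dot0 Y : mxdot Y C = 0.
      rewrite /mxdot big1// => i _; rewrite big1// => j _.
      by rewrite C0 mxE mulr0.
    split=> [|Y _]; last by rewrite !dot0.
    have -> : X = 0.
      by apply/matrixP => i j; rewrite hX C0 !mxE sgr0 mulr0 mul0r.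
    rewrite /group_ball/= /group_norm (_ : \row_i _ = 0) ?lnorm0 ?ltW//.
    by apply/rowP => i; rewrite !mxE row0 lnorm0.
  split=> [|Y Yr].
    rewrite /group_ball/= XE group_normN.
    by rewrite (group_norm_mx_holder_dual s1 hz p1 hq) ?lexx ?ltW.
  rewrite XE mxdotN (mxdot_mx_holder_dual s1 hz p1 hq)// lerNl -mxdotN.
  apply: le_trans (holder_mxdot s1 hz p1 hq _ _) _.
  by rewrite group_normN; apply: ler_wpM2r Yr; exact: group_norm_ge0.
split=> // C0; apply/seteqP; split=> [Y [Yr Ymin]|_ -> //] /=.
(* For a minimizer [Y], the matrix [- Y] attains equality in Hölder's inequality: the upper bound is
   the inequality itself, the lower one is minimality of [Y] against [X]. *)
apply/oppr_inj; rewrite [in RHS]XE opprK.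
apply: (holder_mxdot_eq s1 hz p1 hq C0); first by rewrite group_normN.
rewrite -(mxdot_mx_holder_dual s1 hz p1 hq r C0); apply/eqP.
rewrite eq_le; apply/andP; split.
  rewrite (mxdot_mx_holder_dual s1 hz p1 hq)//.
  apply: le_trans (holder_mxdot s1 hz p1 hq _ _) _.
  by rewrite group_normN; apply: ler_wpM2r Yr; exact: group_norm_ge0.
by rewrite mxdotN lerNr -mxdotN -XE; apply: Ymin; case: opt.
Qed.
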